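(* Let $p$ be a prime and let $\mathfrak A=\langle\mathbb F_p,\mathcal S,\mathbb F_p,S,O\rangle$ be a system, with $s_0\in\mathcal S$ a state from which all states of $\mathfrak A$ are reachable. Then $\mathfrak A$ is completely transitive if and only if $\alpha(f_{\mathfrak A(s_0)})=1$.
   Context: Throughout, $\mathbb F_p=\{0,1,\ldots,p-1\}$ is used as an alphabet, and $\mathbb Z_p$ is the space of $p$-adic integers; $x=\sum_{i\ge 0}\chi_i p^i\in\mathbb Z_p$ (with $\chi_i\in\mathbb F_p$) is identified with the infinite word with letters $\chi_0,\chi_1,\chi_2,\ldots$. System: a tuple $\mathfrak A=\langle\mathbb F_p,\mathcal S,\mathbb F_p,S,O\rangle$ where $\mathcal S$ is a non-empty, possibly infinite, set of states, $S\colon\mathbb F_p\times\mathcal S\to\mathcal S$ is the state transition function and $O\colon\mathbb F_p\times\mathcal S\to\mathbb F_p$ is the output function. For $s\in\mathcal S$, $\mathfrak A(s)$ denotes the automaton obtained by fixing the initial state $s$. A state $t$ is reachable from $s$ if it is the state reached from $s$ after feeding some finite input word. Automaton function: for an input $x=\sum_{i\ge0}\chi_ip^i$ and initial state $s$, put $s^{(0)}=s$, $s^{(i+1)}=S(\chi_i,s^{(i)})$ and $\xi_i=O(\chi_i,s^{(i)})$ for $i=0,1,2,\ldots$; then $f_{\mathfrak A(s)}(x)=\sum_{i\ge0}\xi_ip^i$. For $n\ge 1$ let $W_n$ be the set of words of length $n$ over $\mathbb F_p$, and let $f_{n,\mathfrak A(s)}\colon W_n\to W_n$ be the map sending the input word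 with successive letters $\chi_0,\ldots,\chi_{n-1}$ (fed in this order) to the output word with letters $\xi_0,\ldots,\xi_{n-1}$. Complete transitivity: a family $\mathcal F$ of maps of a finite non-empty set $M$ into itself is transitive if for every $(a,b)\in M\times M$ there is $f\in\mathcal F$ with $f(a)=b$. The system $\mathfrak A$ (equivalently, the automaton $\mathfrak A(s_0)$) is completely transitive if for every $n\in\{1,2,3,\ldots\}$ the family $f_{n,\mathfrak A(s)}$, $s\in\mathcal S$, is transitive on $W_n$. For $x=\sum_{i\ge 0}\chi_ip^i\in\mathbb Z_p$ and $k\ge1$, $x\bmod p^k=\sum_{i=0}^{k-1}\chi_ip^i\in\{0,1,\ldots,p^k-1\}$. For $f\colon\mathbb Z_p\to\mathbb Z_p$ let $$E(f)=\bigcup_{k=1}^\infty\left\{\left(\frac{x\bmod p^k}{p^k},\frac{f(x)\bmod p^k}{p^k}\right)\colon x\in\mathbb Z_p\right\}\subset[0,1]\times[0,1],$$ let $\mathcal E(f)$ be the closure of $E(f)$ in the usual topology of $\mathbb R^2$, and let $\alpha(f)$ be the Lebesgue measure of $\mathcal E(f)$. *)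

(* Defs.v *)
From HB Require Import structures.
From mathcomp Require Import all_boot all_order all_algebra.
From mathcomp Require Import all_classical all_reals all_analysis.
Import numFieldNormedType.Exports.

Set Implicit Arguments.
Unset Strict Implicit.
Unset Printing Implicit Defensive.

(** A p-adic integer is given by its sequence of digits:
    [x : padic_int p] stands for the sum of the [x i * p ^ i], [i >= 0]. *)
Definition padic_int (p : nat) : Type := nat -> 'I_p.

Record system (p : nat) := System {
  state : Type;
  state_inhabited : inhabited state;
  transition : 'I_p -> state -> state;
  output : 'I_p -> state -> 'I_p
}.

Section Automata.
Variables (p : nat) (A : system p).

Definition run (s : state A) (w : seq 'I_p) : state A :=
  foldl (fun t a => transition a t) s w.

Definition reachable (s t : state A) : Prop :=
  exists w : seq 'I_p, run s w = t.

Fixpoint state_at (s : state A) (x : padic_int p) (i : nat) : state A :=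
  if i is j.+1 then transition (x j) (state_at s x j) else s.

Definition automaton_fun (s : state A) (x : padic_int p) : padic_int p :=
  fun i => output (x i) (state_at s x i).

Definition word_fun (n : nat) (s : state A) (w : n.-tuple 'I_p) :
    n.-tuple 'I_p :=
  [tuple output (tnth w i) (run s (take i w)) | i < n].

End Automata.

Definition transitive_family (M : finType) (I : Type) (F : I -> M -> M) : Prop :=
  forall a b : M, exists i : I, F i a = b.

Definition completely_transitive (p : nat) (A : system p) : Prop :=
  forall n : nat, 0 < n -> transitive_family (@word_fun p A n).

(** [x mod p ^ k], as an element of {0, ..., p ^ k - 1}. *)
Definition padic_mod (p : nat) (x : padic_int p) (k : nat) : nat :=
  \sum_(i < k) x i * p ^ i.

Local Open Scope classical_set_scope.
Local Open Scope ring_scope.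

Section Plot.
Variables (R : realType) (p : nat) (f : padic_int p -> padic_int p).

Definition plot_point (k : nat) (x : padic_int p) : R * R :=
  ((padic_mod x k)%:R / (p ^ k)%:R, (padic_mod (f x) k)%:R / (p ^ k)%:R).

Definition plot : set (R * R) :=
  \bigcup_(k in [set k | (0 < k)%N]) [set plot_point k x | x in setT].

Definition plot_closure : set (R * R) := closure plot.

Definition plot_measure : \bar R :=
  ((@lebesgue_measure R) \x (@lebesgue_measure R))%E plot_closure.

End Plot.

(* Main.v *)
Require Import Defs.
From mathcomp Require Import all_boot all_order all_algebra.
From mathcomp Require Import all_classical all_reals all_analysis.
From mathcomp Require Import zify lra.
Import Order.TTheory GRing.Theory Num.Theory.
Import numFieldNormedType.Exports.

Set Implicit Arguments.
Unset Strict Implicit.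
Unset Printing Implicit Defensive.

(** In the fraction [(x mod p ^ k) / p ^ k] the letter read last is the most
    significant digit.  So the last [n] letters read, taken as an integer [c],
    place this fraction in the interval [c / p ^ n, (c + 1) / p ^ n]
    ([coord_cell]), whatever was read before them.  Cut the unit square into
    [p ^ n * p ^ n] cells of side [1 / p ^ n], one for each pair made of an
    input word and an output word of length [n].  A plot point lies in the cell
    of [(a, b)] when the automaton, after reading some prefix, transforms the
    word [a] into the word [b].  Reading a prefix leads to a state reachable
    from the initial one, and all states are reachable, hence complete
    transitivity says exactly that every cell is hit by the plot
    ([transitive_hits_cells]).  It remains to see that every cell of every size
    is hit if and only if the closure of the plot has area 1
    ([plot_measure1P]); this holds for the plot of any function.

    If all cells are hit, the plot is dense in the unit square, since the cells
    are arbitrarily small; its closure is then the unit square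
    ([unit_plot_closure]).  Conversely, if the interior of a cell contained no
    plot point, this open set would also miss the closure of the plot, and the
    closure, being inside the unit square, would have area at most
    [1 - p ^ (- 2 n)].  So some plot point lies in the interior of the cell
    ([plot_meets_cell]).  Such a point comes from a word of more than [n]
    letters, because the points of words of at most [n] letters have coordinates
    that are multiples of [1 / p ^ n] and so lie on the boundaries of cells;
    its last [n] letters are then those of the cell ([coord_open_cell]). *)

(** * Words and residues *)

Section Digits.
Variable p : nat.
Implicit Types x y : padic_int p.

(** The quotient of [x] by [p ^ m] in the p-adic integers. *)
Definition shift (m : nat) x : padic_int p := fun i => x (m + i).

Definition word_prefix (n : nat) x : n.-tuple 'I_p := [tuple x i | i < n].

(** [y] also serves to build the default value of [nth]: past the end of [w],
    the default is the letter of [y] at the offset position. *)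
Definition prepend (w : seq 'I_p) y : padic_int p :=
  fun i => nth (y (i - size w)) w i.

Lemma shift_prepend w y : shift (size w) (prepend w y) = y.
Proof.
apply/funext => i; rewrite /shift /prepend nth_default ?leq_addr//.
by rewrite addKn.
Qed.

Lemma mkseq_prepend w y : mkseq (prepend w y) (size w) = w.
Proof.
case: w => [//|a w]; apply: (@eq_from_nth _ a) => [|i].
  by rewrite size_mkseq.
rewrite size_mkseq => ltiw; rewrite nth_mkseq// /prepend.
exact: set_nth_default.
Qed.

Lemma val_word_prefix n x : word_prefix n x = mkseq x n :> seq 'I_p.
Proof. by rewrite /= /mkseq -val_enum_ord -map_comp. Qed.

Lemma word_prefix_surj n (w : n.-tuple 'I_p) :
  0 < p -> exists x, word_prefix n x = w.
Proof.
move=> p_gt0; exists (prepend w (fun=> Ordinal p_gt0)).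
apply: val_inj; rewrite [LHS]val_word_prefix.
by rewrite -[RHS](mkseq_prepend _ (fun=> Ordinal p_gt0)) size_tuple.
Qed.

Lemma padic_modS x n : padic_mod x n.+1 = padic_mod x n + x n * p ^ n.
Proof. by rewrite /padic_mod big_ord_recr. Qed.

Lemma padic_mod_add x m n :
  padic_mod x (m + n) = padic_mod x m + padic_mod (shift m x) n * p ^ m.
Proof.
elim: n => [|n IHn]; first by rewrite addn0 /padic_mod big_ord0 addn0.
rewrite addnS !padic_modS IHn /shift expnD mulnDl -addnA -!mulnA.
by rewrite (mulnC (p ^ m)).
Qed.

Lemma padic_mod_lt x n : padic_mod x n < p ^ n.
Proof.
elim: n => [|n IHn]; first by rewrite /padic_mod big_ord0.
by rewrite padic_modS expnS; have := ltn_ord (x n); nia.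
Qed.

Lemma padic_mod_inj x y n :
  padic_mod x n = padic_mod y n -> word_prefix n x = word_prefix n y.
Proof.
move=> xyn; apply: val_inj; rewrite /= !val_word_prefix.
elim: n xyn => [//|n IHn]; rewrite !padic_modS => xyn.
have [xn yn] := (padic_mod_lt x n, padic_mod_lt y n).
have /= xy : x n = y n :> nat by nia.
rewrite !mkseqS IHn; last by move: xyn; rewrite xy => /addIn.
by congr rcons; exact: val_inj.
Qed.

Lemma padic_mod_prefix x y n :
  word_prefix n x = word_prefix n y -> padic_mod x n = padic_mod y n.
Proof.
move=> xy; apply: eq_bigr => i _; congr (nat_of_ord _ * _).
rewrite -[x i](tnth_mktuple (fun i => x i)) -/(word_prefix n x) xy.
by rewrite tnth_mktuple.
Qed.

Lemma padic_mod_surj n c : 0 < p -> c < p ^ n -> exists x, padic_mod x n = c.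
Proof.
move=> p_gt0; elim: n c => [|n IHn] c ltc.
  exists (fun=> Ordinal p_gt0); move: ltc; rewrite /padic_mod big_ord0.
  by case: c.
have pn_gt0 : 0 < p ^ n by rewrite expn_gt0 p_gt0.
have ltd : c %/ p ^ n < p by rewrite ltn_divLR// -expnS.
have [x xc] := IHn _ (ltn_pmod c pn_gt0).
exists (fun i => if i < n then x i else Ordinal ltd).
rewrite padic_modS ltnn [RHS](divn_eq c (p ^ n)) addnC -xc; congr (_ + _).
by apply: eq_bigr => i _; rewrite ltn_ord.
Qed.

Lemma padic_mod_cell x m n (c := padic_mod (shift m x) n) :
  c * p ^ m <= padic_mod x (m + n) < c.+1 * p ^ m.
Proof. by rewrite padic_mod_add -/c; have := padic_mod_lt x m; nia. Qed.

(** If [k <= n], then [padic_mod x k * p ^ n] is a multiple of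
    [p ^ k], which the strict bounds exclude; so [k] is larger than [n], and
    the intervals of distinct cells do not overlap. *)
Lemma padic_mod_open_cell x k n c :
  c * p ^ k < padic_mod x k * p ^ n < c.+1 * p ^ k ->
  exists2 m, k = m + n & padic_mod (shift m x) n = c.
Proof.
case: (leqP k n) => [kn|/ltnW/subnK km /andP[lo hi]].
  rewrite -(subnK kn) expnD mulnA => /andP[].
  case: (posnP (p ^ k)) => [->|pk_gt0]; first by rewrite !muln0.
  by rewrite !ltn_pmul2r// ltnS => /leq_trans/[apply]; rewrite ltnn.
exists (k - n); rewrite ?km//.
have := padic_mod_cell x (k - n) n; rewrite km; move: lo hi.
have -> : p ^ k = p ^ (k - n) * p ^ n by rewrite -expnD km.
rewrite !mulnA; have [->|pn_gt0] := posnP (p ^ n); first by rewrite !muln0.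
rewrite !ltn_pmul2r//.
move: (padic_mod (shift _ _) _) => d lo hi /andP[dlo dhi].
have := leq_ltn_trans dlo hi; have := ltn_trans lo dhi.
have [->|pm_gt0] := posnP (p ^ (k - n)); first by rewrite !muln0.
by rewrite !ltn_pmul2r// !ltnS => ? ?; apply/eqP; rewrite eqn_leq; apply/andP.
Qed.

End Digits.

(** * Words read by the automaton *)

Section Automaton.
Variables (p : nat) (A : system p).
Implicit Types (s : state A) (x : padic_int p).

Lemma run_mkseq s x i : run s (mkseq x i) = state_at s x i.
Proof.
by elim: i => [//|i IHi]; rewrite mkseqS /run foldl_rcons -/(run _ _) IHi.
Qed.

Lemma state_at_add s x m i :
  state_at s x (m + i) = state_at (state_at s x m) (shift m x) i.
Proof. by elim: i => [|i IHi]; rewrite ?addn0// addnS /= IHi. Qed.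

(** Reading a prefix only changes the initial state: this is what turns the
    far digits of one function into the low digits of the functions attached to
    all reachable states. *)
Lemma shift_automaton_fun s x m :
  shift m (automaton_fun s x) = automaton_fun (state_at s x m) (shift m x).
Proof. by apply/funext => i; rewrite /shift /automaton_fun state_at_add. Qed.

Lemma word_fun_prefix n s x :
  word_fun s (word_prefix n x) = word_prefix n (automaton_fun s x).
Proof.
apply: eq_from_tnth => i; rewrite !tnth_mktuple val_word_prefix.
rewrite -map_take take_iota (minn_idPl (ltnW (ltn_ord i))).
by rewrite run_mkseq.
Qed.

End Automaton.

(** Geometrically, every half-open cell of side [1 / p ^ n] of the unit square
    contains a plot point of [f] that comes from at least [n] letters. *)
Definition hits_cells (p : nat) (f : padic_int p -> padic_int p) (n : nat) :=
  forall a b, a < p ^ n -> b < p ^ n ->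
  exists m x, padic_mod (shift m x) n = a /\ padic_mod (shift m (f x)) n = b.

(** A state sending the word [a] to the word [b] is reached by some word [w],
    and then [w] followed by [a] hits the cell of [(a, b)]; conversely, when an
    input hits this cell, the state reached before its last [n] letters sends
    [a] to [b]. *)
Lemma transitive_hits_cells (p : nat) (A : system p) (s0 : state A) n :
    0 < p -> (forall t, reachable s0 t) ->
  transitive_family (@word_fun p A n) <-> hits_cells (automaton_fun s0) n.
Proof.
move=> p_gt0 hs0; split => [tr a b lta ltb|hits u v].
  have [y ya] := padic_mod_surj p_gt0 lta.
  have [z zb] := padic_mod_surj p_gt0 ltb.
  have [s syz] := tr (word_prefix n y) (word_prefix n z).
  have [w ws] := hs0 s; exists (size w), (prepend w y).
  rewrite shift_automaton_fun shift_prepend -run_mkseq mkseq_prepend ws.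
  by split=> //; rewrite -zb; apply: padic_mod_prefix; rewrite -word_fun_prefix.
have [y <-] := word_prefix_surj u p_gt0.
have [z <-] := word_prefix_surj v p_gt0.
have [m [x [xy fxz]]] := hits _ _ (padic_mod_lt y n) (padic_mod_lt z n).
exists (state_at s0 x m).
rewrite -(padic_mod_inj xy) word_fun_prefix -shift_automaton_fun.
exact: padic_mod_inj.
Qed.

Local Open Scope classical_set_scope.
Local Open Scope ring_scope.

(** * Open and closed sets of the plane *)

Section SetX.
Variables T1 T2 : topologicalType.

Lemma open_setX (A : set T1) (B : set T2) :
  open A -> open B -> open (A `*` B).
Proof.
move=> oA oB; have -> : A `*` B = fst @^-1` A `&` snd @^-1` B by [].
apply: openI; apply: open_comp => // -[x y] _; first exact: cvg_fst.
exact: cvg_snd.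
Qed.

Lemma closed_setX (A : set T1) (B : set T2) :
  closed A -> closed B -> closed (A `*` B).
Proof.
move=> cA cB; have -> : A `*` B = fst @^-1` A `&` snd @^-1` B by [].
apply: closedI; apply: closed_comp => // -[x y] _; first exact: cvg_fst.
exact: cvg_snd.
Qed.

End SetX.

Section PlaneMeasurable.
Variable R : realType.

(** The plane carries the product sigma-algebra: an open set belongs to it
    because it is the countable union of the open rectangles with rational
    vertices that it contains. *)
Lemma open_measurable_plane (U : set (R * R)) : open U -> measurable U.
Proof.
move=> oU.
pose B (i : (rat * rat) * (rat * rat)) : set (R * R) :=
  `](ratr i.1.1), (ratr i.1.2)[ `*` `](ratr i.2.1), (ratr i.2.2)[.
have -> : U = \bigcup_i (if `[< B i `<=` U >] then B i else set0).
  apply/seteqP; split => [[x y] Uxy|z [i _]]; last first.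
    by case: asboolP => // BU /BU.
  have /nbhs_ballP[e /= e0 eU] := open_nbhs_nbhs (conj oU Uxy).
  have [a] : exists q, ratr q \in `](x - e), x[ by apply: rat_in_itvoo; lra.
  have [b] : exists q, ratr q \in `]x, (x + e)[ by apply: rat_in_itvoo; lra.
  have [c] : exists q, ratr q \in `](y - e), y[ by apply: rat_in_itvoo; lra.
  have [d] : exists q, ratr q \in `]y, (y + e)[ by apply: rat_in_itvoo; lra.
  rewrite !in_itv/= => /andP[d1 d2] /andP[c1 c2] /andP[b1 b2] /andP[a1 a2].
  exists ((a, b), (c, d)) => //; case: asboolP => [_|]; last first.
    case=> -[u v]; rewrite /B/= !in_itv/= => -[/andP[? ?] /andP[? ?]].
    by apply: eU; split; rewrite /= ball_itv/= in_itv/=; apply/andP; split; lra.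
  by rewrite /B/= !in_itv/=; split; apply/andP.
apply: countable_bigcupT_measurable => [|i]; first exact: countableP.
case: asboolP => // _; apply: measurableX; exact: measurable_itv.
Qed.

Lemma closed_measurable_plane (C : set (R * R)) : closed C -> measurable C.
Proof.
move=> cC; rewrite -(setCK C); apply: measurableC.
by apply: open_measurable_plane; exact: closed_openC.
Qed.

End PlaneMeasurable.

(** * The area of the closure of a plot *)

Section Plot.
Variables (R : realType) (p : nat) (f : padic_int p -> padic_int p).
Hypothesis p_gt1 : (1 < p)%N.
Implicit Types x : padic_int p.

Let area := ((@lebesgue_measure R) \x (@lebesgue_measure R))%E.

Let unit_square : set (R * R) := `[0, 1] `*` `[0, 1].

Let coord k x : R := (padic_mod x k)%:R / (p ^ k)%:R.

Let pow_gt0 k : 0 < (p ^ k)%:R :> R.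
Proof. by rewrite ltr0n expn_gt0 ltnW. Qed.

Lemma coord_unit k x : 0 <= coord k x <= 1.
Proof.
rewrite divr_ge0 ?ler0n//= ler_pdivrMr// mul1r ler_nat.
exact/ltnW/padic_mod_lt.
Qed.

Lemma coord_cell x m n (c := padic_mod (shift m x) n) :
  c%:R / (p ^ n)%:R <= coord (m + n) x <= c.+1%:R / (p ^ n)%:R.
Proof.
have /andP[cm cM] := padic_mod_cell x m n.
have pm (d : nat) : d%:R / (p ^ n)%:R = (d * p ^ m)%:R / (p ^ (m + n))%:R :> R.
  by rewrite addnC expnD !natrM -mulf_div divff ?mulr1// gt_eqF.
by rewrite !pm !ler_pM2r ?invr_gt0// !ler_nat cm ltnW.
Qed.

Lemma coord_open_cell x k n c :
  c%:R / (p ^ n)%:R < coord k x < c.+1%:R / (p ^ n)%:R ->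
  exists2 m, k = (m + n)%N & padic_mod (shift m x) n = c.
Proof.
rewrite ltr_pdivrMr// ltr_pdivlMr// /coord !(mulrAC _ _^-1).
rewrite ltr_pdivlMr// ltr_pdivrMr// -!natrM !ltr_nat.
exact: padic_mod_open_cell.
Qed.

Lemma plot_closure_unit : @plot_closure R p f `<=` unit_square.
Proof.
have <- : closure unit_square = unit_square.
  by apply/esym/closure_id; apply: closed_setX; exact: itv_closed.
apply: closureS => _ [k _ [x _ <-]].
by split; rewrite /= in_itv/= coord_unit.
Qed.

Lemma area_rectangle (X Y : set R) : measurable X -> measurable Y ->
  area (X `*` Y) = (lebesgue_measure X * lebesgue_measure Y)%E.
Proof.
move=> mX mY.
exact: (@product_measure1E _ _ _ _ R lebesgue_measure lebesgue_measure).
Qed.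

Lemma area_unit_square : area unit_square = 1%E.
Proof.
rewrite area_rectangle; try exact: measurable_itv.
by rewrite lebesgue_measure_itv/= lte_fin ltr01 oppr0 adde0 mule1.
Qed.

(** The point [u = 1] has to be put in the last cell, which is why the cells
    are taken closed here. *)
Lemma unit_cell (u : R) n : 0 <= u <= 1 ->
  exists2 c, (c < p ^ n)%N & c%:R / (p ^ n)%:R <= u <= c.+1%:R / (p ^ n)%:R.
Proof.
move=> /andP[u0 u1]; have /orP[/eqP ->|{}u1] : (u == 1) || (u < 1).
  by rewrite -le_eqVlt.
  exists (p ^ n).-1; rewrite prednK ?expn_gt0 ?(ltnW p_gt1)//.
  by rewrite divff ?gt_eqF// lexx andbT ler_pdivrMr// mul1r ler_nat leq_pred.
have up0 : 0 <= u * (p ^ n)%:R by rewrite mulr_ge0// ltW.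
have /andP[lo hi] := truncn_itv up0.
exists (Num.truncn (u * (p ^ n)%:R)).
  by rewrite -(ltr_nat R) (le_lt_trans lo)// gtr_pMl.
by rewrite ler_pdivrMr// lo ler_pdivlMr// ltW.
Qed.

Lemma expn_small (e : R) : 0 < e -> exists2 n, (0 < n)%N & ((p ^ n)%:R)^-1 < e.
Proof.
move=> e0; have [k _ /(_ k (leqnn k)) kP] := near_infty_natSinv_lt (PosNum e0).
exists k.+1 => //; apply: le_lt_trans kP.
by rewrite lef_pV2 ?posrE ?pow_gt0 ?ltr0n// ler_nat ltnW// ltn_expl.
Qed.

Lemma unit_plot_closure :
  (forall n, (0 < n)%N -> hits_cells f n) ->
  unit_square `<=` @plot_closure R p f.
Proof.
move=> hits [u v] [/= + +]; rewrite !in_itv/= => u01 v01 N.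
move=> /nbhs_ballP[e /= e0 eN].
have [n n0 ne] := expn_small e0.
have [a lta /andP[au ua]] := unit_cell n u01.
have [b ltb /andP[bv vb]] := unit_cell n v01.
have [m [x [xa xb]]] := hits n n0 a b lta ltb.
exists (plot_point R f (m + n) x); split.
  by exists (m + n)%N; [rewrite /= addn_gt0 n0 orbT|exists x].
have := coord_cell x m n; have := coord_cell (f x) m n.
rewrite xa xb => /andP[b1 b2] /andP[a1 a2].
(* Linear arithmetic needs (c + 1) / p ^ n as c / p ^ n + 1 / p ^ n. *)
move: ua vb a2 b2; rewrite -!natr1 !mulrDl !mul1r => *.
by apply: eN; split; rewrite /= ball_itv/= in_itv/=; apply/andP; split;
  rewrite -/(coord _ _); lra.
Qed.

(** An open set that misses the plot misses its closure; if the interior [Q]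
    of the cell did, the closure and [Q] would be disjoint parts of the unit
    square with total area larger than 1. *)
Lemma plot_meets_cell n a b : (a < p ^ n)%N -> (b < p ^ n)%N ->
    plot_measure R f = 1%E ->
  exists2 z : R * R, @plot R p f z &
    (a%:R / (p ^ n)%:R < z.1 < a.+1%:R / (p ^ n)%:R) /\
    (b%:R / (p ^ n)%:R < z.2 < b.+1%:R / (p ^ n)%:R).
Proof.
move=> lta ltb meas1.
pose I (c : nat) : set R :=
  [set` `](c%:R / (p ^ n)%:R), (c.+1%:R / (p ^ n)%:R)[].
pose Q := I a `*` I b.
suff /set0P[z [pz [/= z1 z2]]] : @plot R p f `&` Q != set0.
  by exists z => //; move: z1 z2; rewrite /I /= !in_itv.
apply/eqP => PQ0.
have oI c : open (I c) by exact: itv_open.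
have oQ : open Q by exact: open_setX.
have mC : measurable (@plot_closure R p f).
  by apply: closed_measurable_plane; exact: closed_closure.
have mQ : measurable Q by apply: measurableX; exact: measurable_itv.
have CQ0 : @plot_closure R p f `&` Q = set0.
  apply/eqP/negPn/negP => /set0P[z [Cz Qz]].
  have := Cz Q (open_nbhs_nbhs (conj oQ Qz)).
  by rewrite PQ0 => -[].
have IU c : (c < p ^ n)%N -> I c `<=` `[0, 1].
  move=> ltc t; rewrite /I /= !in_itv/= => /andP[t1 t2]; apply/andP; split.
    by rewrite (le_trans _ (ltW t1))// divr_ge0 ?ler0n.
  by rewrite (le_trans (ltW t2))// ler_pdivrMr// mul1r ler_nat.
have QU : Q `<=` unit_square.
  by move=> z [/= z1 z2]; split; [exact: (IU a)|exact: (IU b)].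
have areaI c : lebesgue_measure (I c) = ((p ^ n)%:R^-1)%:E.
  rewrite /I lebesgue_measure_itv/= lte_fin ltr_pM2r ?invr_gt0// ltr_nat ltnSn.
  by rewrite -EFinB -mulrBl -natr1 addrAC subrr add0r mul1r.
have areaQ : area Q = ((p ^ n)%:R^-1 * (p ^ n)%:R^-1)%:E.
  rewrite area_rectangle; try exact: measurable_itv.
  by rewrite !areaI EFinM.
have : (area (@plot_closure R p f `|` Q) <= area unit_square)%E.
  apply: le_measure; rewrite ?inE.
  - exact: measurableU.
  - by apply: measurableX; exact: measurable_itv.
  - by rewrite subUset; split => //; exact: plot_closure_unit.
have -> : area (@plot_closure R p f `|` Q) =
    (area (@plot_closure R p f) + area Q)%E by exact: measureU.
rewrite area_unit_square areaQ [X in (X + _)%E]meas1 -EFinD lee_fin.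
by rewrite leNgt ltrDl mulr_gt0 ?invr_gt0.
Qed.

Lemma plot_measure1P :
  (forall n, (0 < n)%N -> hits_cells f n) <-> plot_measure R f = 1%E.
Proof.
split=> [hits|meas1 n n0 a b lta ltb].
  rewrite /plot_measure (_ : @plot_closure R p f = unit_square); last first.
    apply/seteqP; split; [exact: plot_closure_unit|exact: unit_plot_closure].
  exact: area_unit_square.
have [z [k _ [x _ <-]] [xa xb]] := plot_meets_cell lta ltb meas1.
have [m km xma] := coord_open_cell xa; have [m' km' xmb] := coord_open_cell xb.
(* Both coordinates have the same length k, hence the same m = k - n. *)
by exists m, x; split => //; have -> : m = m' by lia.
Qed.

End Plot.

Theorem theorem4p2 (R : realType) (p : nat) (hp : prime p) (A : system p)
    (s0 : state A) (hs0 : forall t : state A, reachable s0 t) :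
  completely_transitive A <-> plot_measure R (automaton_fun s0) = 1%E.
Proof.
rewrite -plot_measure1P ?prime_gt1//.
split=> tr n n0; apply/(transitive_hits_cells n (prime_gt0 hp) hs0);
  exact: tr.
Qed.
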